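(* Let $k$ be a field, $R=k[x_1,\ldots,x_d]$, and let $(C_n,\alpha)$ be an edge labeled cycle with edge labels $l_1,\ldots,l_n\in R$. If $\operatorname{rk} C_n\le 2$, then the spline module $R_{(C_n,\alpha)}$ is a free $R$-module.
   Context: An edge labeled graph $(G,\alpha)$ over a commutative ring $R$ is a finite graph $G=(V,E)$ together with a function $\alpha$ assigning to each edge an ideal of $R$; here each edge $e$ is labeled by an element $l_e\in R$, standing for the principal ideal $\alpha(e)=\langle l_e\rangle$. A generalized spline on $(G,\alpha)$ is a vertex labeling $(f_v)_{v\in V}\in R^{|V|}$ such that $f_u-f_v\in\alpha(uv)$ for every edge $uv\in E$. The set of all generalized splines is the $R$-submodule $R_{(G,\alpha)}\subseteq R^{|V|}$. An edge labeled cycle $(C_n,\alpha)$ is an edge labeled graph whose underlying graph is a cycle with $n$ edges, labeled $l_1,\ldots,l_n$. Its rank $\operatorname{rk} C_n$ is the dimension over $k$ of the $k$-linear span of $l_1,\ldots,l_n$ in $R$. *)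

(* Defs.v *)
From HB Require Import structures.
From mathcomp Require Import all_boot all_algebra.
From mathcomp Require Import boolp.
From mathcomp Require Import mpoly.

Set Implicit Arguments.
Unset Strict Implicit.
Unset Printing Implicit Defensive.

Import GRing.Theory.
Local Open Scope ring_scope.

Section LinearAlgebra.
Variables (A : nzRingType) (M : lmodType A).

Definition in_span (I : Type) (b : I -> M) (x : M) : Prop :=
  exists (s : seq I) (c : I -> A), x = \sum_(i <- s) c i *: b i.

Definition lin_indep (I : eqType) (b : I -> M) : Prop :=
  forall (s : seq I) (c : I -> A), uniq s ->
    \sum_(i <- s) c i *: b i = 0 -> forall i, i \in s -> c i = 0.

Definition is_free_module : Prop :=
  exists (I : choiceType) (b : I -> M),
    lin_indep b /\ (forall x : M, in_span b x).

End LinearAlgebra.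

(* The linear span of the family [l] has dimension [r] over [K]; stated as a
   relation because the ambient space [M] may be infinite dimensional. *)
Definition span_dim (K : fieldType) (M : lmodType K) (I : Type) (l : I -> M)
    (r : nat) : Prop :=
  exists b : 'I_r -> M,
    lin_indep b /\ (forall x : M, in_span b x <-> in_span l x).

(* Ideals of a commutative ring are the submodules of its regular module; the
   unit ideal is allowed, contrary to the ideals of [ring_quotient]. *)
Notation ideal R := (submodClosed R^o).

Section PrincipalIdeal.
Variables (R : comNzRingType) (a : R).

Definition principal_pred : {pred R^o} := fun x => `[< exists q : R, x = q * a >].

Fact principal_submod_closed : submod_closed principal_pred.
Proof.
split=> [|c x y /asboolP[p ->] /asboolP[q ->]]; apply/asboolP.
  by exists 0; rewrite mul0r.
by exists (c * p + q); rewrite mulrDl -mulrA.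
Qed.

HB.instance Definition _ :=
  GRing.isSubmodClosed.Build R R^o principal_pred principal_submod_closed.

Definition principal : ideal R := principal_pred.

End PrincipalIdeal.

Record graph := Graph {
  vertex :> finType;
  edges : {set {set vertex}};
  _ : forall e, e \in edges -> #|e| = 2%N
}.

Definition edge (G : graph) := {e : {set G} | e \in edges G}.

Definition is_cycle (n : nat) (G : graph) : Prop :=
  (2 < n)%N /\
  exists v : 'I_n -> G, bijective v /\
    edges G = [set [set v i; v (ordS i)] | i : 'I_n].

Section Splines.
Variables (R : comNzRingType) (G : graph) (alpha : edge G -> ideal R).

Definition is_spline (f : {ffun G -> R^o}) : Prop :=
  forall (e : edge G) (u v : G), val e = [set u; v] -> f u - f v \in alpha e.

Definition spline_pred : {pred {ffun G -> R^o}} := fun f => `[< is_spline f >].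

Fact spline_submod_closed : submod_closed spline_pred.
Proof.
split=> [|c f g /asboolP Sf /asboolP Sg]; apply/asboolP=> e u v Euv.
  by rewrite !ffunE subrr; apply: (rpred0 (alpha e)).
rewrite !ffunE opprD addrACA -scalerBr.
exact: (rpredD (rpredZ c (Sf _ _ _ Euv)) (Sg _ _ _ Euv)).
Qed.

HB.instance Definition _ :=
  GRing.isSubmodClosed.Build R {ffun G -> R^o} spline_pred spline_submod_closed.

Record spline := Spline {
  spline_val :> {ffun G -> R^o};
  _ : spline_val \in spline_pred
}.

HB.instance Definition _ := [isSub for spline_val].
HB.instance Definition _ := [Choice of spline by <:].
HB.instance Definition _ := [SubChoice_isSubLmodule of spline by <:].

End Splines.

(* Main.v *)
From HB Require Import structures.
Require Import Defs.
From mathcomp Require Import all_boot all_algebra.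
From mathcomp Require Import boolp mpoly.
From mathcomp Require Import ring.

(** Write the cycle as [v_0, ..., v_(n-1)], with [l_i] the label of the edge
    from [v_i] to [v_(i+1)].  A spline is determined by its value at [v_0] and
    its differences [f v_(i+1) - f v_i = a_i l_i], which are subject to the
    single relation [\sum_i a_i l_i = 0].  The coefficient [a_i] is unique when
    [l_i != 0] and can be normalized to [0] when [l_i = 0].  So the spline module
    is [R] plus the syzygy module of the nonzero labels
    ([cycle_splines_free]), and it suffices that the latter is free.

    If the labels lie in a [k]-space of dimension at most 2, Gaussian elimination
    over [k], which is an invertible change of basis of [R^m], replaces them by
    [p, q, 0, ..., 0] ([free_kernel_rank2]).  Each zero contributes a free
    summand, and the syzygies of [(p, q)] are free of rank one when
    [(p, q) <> (0, 0)]: they are the multiples of [(q / g, - p / g)] with [g] a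
    gcd of [p] and [q] ([free_kernel2]).

    This last step needs [k[x_1, ..., x_d]] to have gcds.  That holds by
    induction on [d], as having gcds passes from a domain [A] to [A[X]]
    ([gcd_domain_poly]).  The proof of the latter combines the gcd of pseudo-
    division, which is the gcd over the fraction field, with Gauss' lemma
    ([Gauss_divides]). *)

Set Implicit Arguments.
Unset Strict Implicit.
Unset Printing Implicit Defensive.
Import GRing.Theory.
Local Open Scope ring_scope.

(** * Domains with gcds *)

Section Divisibility.
Variable A : idomainType.
Implicit Types a b c h x y : A.

Definition divides a b : Prop := exists c, b = c * a.

(** The clause on [h] says that [x] is a gcd of [x * a'] and [x * b'] for every
    [x].  This makes coprimality stable under scaling, which mere absence of
    nonunit common divisors does not give in a general domain; it contains
    Euclid's lemma as the case where [h] is [a'] or [b'].  For [a = b = 0] one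
    takes [g = 0]. *)
Definition gcd_domain : Prop := forall a b, exists g a' b',
  [/\ a = g * a', b = g * b' &
      forall h x, divides h (x * a') -> divides h (x * b') -> divides h x].

Lemma divides_refl a : divides a a.
Proof. by exists 1; rewrite mul1r. Qed.

Lemma divides0 a : divides a 0.
Proof. by exists 0; rewrite mul0r. Qed.

Lemma dividesD a b c : divides a b -> divides a c -> divides a (b + c).
Proof. by case=> x -> [y ->]; exists (x + y); rewrite mulrDl. Qed.

Lemma dividesN a b : divides a b -> divides a (- b).
Proof. by case=> x ->; exists (- x); rewrite mulNr. Qed.

Lemma divides_mull c a b : divides a b -> divides a (c * b).
Proof. by case=> x ->; exists (c * x); rewrite mulrA. Qed.

Lemma divides_mulr c a b : divides a b -> divides a (b * c).
Proof. by rewrite mulrC; apply: divides_mull. Qed.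

Lemma divides_trans b a c : divides a b -> divides b c -> divides a c.
Proof. by case=> x -> [y ->]; exists (y * x); rewrite mulrA. Qed.

Lemma divides_mul2l c a b : c != 0 -> divides (c * a) (c * b) <-> divides a b.
Proof.
move=> c0; split=> [[x E]|[x ->]]; last by exists x; rewrite mulrCA.
by exists x; apply: (mulfI c0); rewrite E mulrCA.
Qed.

Lemma divides0l a : divides 0 a -> a = 0.
Proof. by case=> x ->; rewrite mulr0. Qed.

(** In the notation of ideals, [(a) : (b) = (a / gcd a b)]. *)
Lemma colon_principal a b : gcd_domain -> a != 0 ->
  exists r, forall x, divides a (b * x) <-> divides r x.
Proof.
move=> gcdA a0; have [g [a' [b' [Ea Eb cop]]]] := gcdA a b.
have g0 : g != 0 by apply: contraNneq a0 => g0; rewrite Ea g0 mul0r.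
exists a' => x; rewrite Ea Eb -mulrA divides_mul2l //; split=> [dv|].
  by apply: cop; [apply/divides_mull/divides_refl | rewrite mulrC].
exact: divides_mull.
Qed.

(** A generator [r] of [(a) : (b)] divides [a], because [a] lies in that ideal,
    and the gcd is recovered as [a / r]. *)
Lemma gcd_domain_of_colon :
  (forall a b, a != 0 -> exists r, forall x, divides a (b * x) <-> divides r x) ->
  gcd_domain.
Proof.
move=> colon a b; have [->|a0] := eqVneq a 0.
  exists b, 0, 1; split; rewrite ?mulr0 ?mulr1 // => h x _.
  by rewrite mulr1.
have [r rP] := colon a b a0.
have [g Ea] : divides r a by apply/rP/divides_mull/divides_refl.
have [b' Eb] : divides a (b * r) by apply/rP/divides_refl.
have r0 : r != 0 by apply: contraNneq a0 => r0; rewrite Ea r0 mulr0.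
have g0 : g != 0 by apply: contraNneq a0 => g0; rewrite Ea g0 mul0r.
have {}Eb : b = g * b' by apply: (mulIf r0); rewrite Eb Ea; ring.
exists g, r, b'; split=> // h x [m Em] [n En].
have [h0|h0] := eqVneq h 0.
  move: Em; rewrite h0 mulr0 => /eqP; rewrite mulf_eq0 (negPf r0) orbF => /eqP->.
  exact: divides0.
(* From [x r = m h] and [x b' = n h], cancelling [h] gives [r n = m b'], and
   [r] is coprime to [b']. *)
have [m' Em'] : divides r m.
  apply/rP; rewrite Ea Eb -mulrA divides_mul2l //; exists n.
  apply: (mulIf h0); rewrite -mulrA -Em; transitivity (x * b' * r); first by ring.
  by rewrite En; ring.
by exists m'; apply: (mulIf r0); rewrite Em Em'; ring.
Qed.

End Divisibility.

(** * Gauss' lemma and gcds of polynomials *)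

Section Gauss.
Variable A : idomainType.
Implicit Types (c h x : A) (u w p q : {poly A}).

(** The coefficients of [u] have gcd [1], in the scaling-stable sense used in
    [gcd_domain]. *)
Definition primitive u : Prop :=
  forall h x, (forall i, divides h (x * u`_i)) -> divides h x.

Lemma divides_polyC c w : divides c%:P w <-> forall i, divides c w`_i.
Proof.
split=> [[q ->] i|dv]; first by exists q`_i; rewrite coefMC.
have [q qP] := choice dv; exists (\poly_(i < size w) q i).
apply/polyP=> i; rewrite coefMC coef_poly; case: ltnP => [_|le]; first exact: qP.
by rewrite mul0r nth_default.
Qed.

Lemma scale_poly_inj c : c != 0 -> injective ( *:%R c : {poly A} -> {poly A}).
Proof.
by move=> c0 p q /= E; apply: (@mulfI _ c%:P); rewrite ?polyC_eq0 ?mul_polyC.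
Qed.

Lemma content_primitive u : gcd_domain A ->
  exists e u', u = e *: u' /\ primitive u'.
Proof.
move=> gcdA; elim/poly_ind: u => [|p c [e [p' [-> prim]]]].
  exists 0, 1; split=> [|h x /(_ 0%N)]; first by rewrite scale0r.
  by rewrite coef1 mulr1.
have [g [e' [c' [-> -> cop]]]] := gcdA e c.
exists g, (e' *: p' * 'X + c'%:P); split=> [|h x dv].
  by rewrite scalerDr -mul_polyC polyCM -!mul_polyC; ring.
apply: cop; last by have := dv 0%N; rewrite coefD coefMX coefC /= add0r.
apply: prim => i; have := dv i.+1.
by rewrite coefD coefMX coefC /= addr0 coefZ mulrA.
Qed.

Lemma size_sub_lead u : u != 0 ->
  (size (u - lead_coef u *: 'X^((size u).-1))%R < size u)%N.
Proof.
move=> u0; rewrite (polySpred u0) ltnS; apply/leq_sizeP=> j le.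
rewrite coefB coefZ coefXn; case: eqP => [->|/eqP ne].
  by rewrite mulr1 /lead_coef subrr.
rewrite mulr0 subr0 nth_default // (polySpred u0).
by rewrite ltn_neqAle eq_sym ne.
Qed.

Lemma divides_coef_sub_lead c w u :
  (forall i, divides c (w * u)`_i) -> divides c (lead_coef w) ->
  forall i, divides c ((w - lead_coef w *: 'X^((size w).-1)) * u)`_i.
Proof.
move=> dv dvl i; rewrite mulrBl coefB; apply: dividesD => //; apply: dividesN.
by rewrite -scalerAl coefZ; apply: divides_mulr.
Qed.

Lemma coef_sub_lead w i :
  w`_i = (w - lead_coef w *: 'X^((size w).-1))`_i +
         lead_coef w * (i == (size w).-1)%:R.
Proof. by rewrite coefB coefZ coefXn subrK. Qed.

(** Gauss' lemma in a form without contents: modulo any [c], a product vanishes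
    only if all products of coefficients do.  The induction strips leading terms.
    Making [u] primitive first, [g = gcd c (lead_coef w)] divides
    [w - lead_coef w *: 'X^_] times [u], hence [w] by induction.  After division
    by [g] the cofactor [c'] is coprime to the leading coefficient of the first
    factor, so it divides that of [u], and stripping the leading term of [u]
    concludes. *)
Lemma Gauss_divides c w u : gcd_domain A ->
  (forall i, divides c (w * u)`_i) -> forall i j, divides c (w`_i * u`_j).
Proof.
move=> gcdA; have [n] := ubnP (size w + size u).
elim: n => // n IHn in c w u *; rewrite ltnS => le_n dv i j.
have [w0|w0] := eqVneq w 0; first by rewrite w0 coef0 mul0r; apply: divides0.
have [u0|u0] := eqVneq u 0; first by rewrite u0 coef0 mulr0; apply: divides0.
have [c0|c0] := eqVneq c 0.
  have /eqP : w * u = 0.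
    apply/polyP=> m; rewrite coef0; apply: divides0l.
    by case: (dv m) => x ->; exists x; rewrite c0.
  by rewrite mulf_eq0 (negPf w0) (negPf u0).
have [e [u' [Eu prim]]] := content_primitive u gcdA.
have e0 : e != 0 by apply: contraNneq u0 => e0; rewrite Eu e0 scale0r.
have u'0 : u' != 0 by apply: contraNneq u0 => u'0; rewrite Eu u'0 scaler0.
have {}dv m : divides c ((e *: w) * u')`_m.
  by have := dv m; rewrite Eu -scalerAr scalerAl.
(* Move the content of [u] to [w], so that [u'] replaces [u]. *)
suff : divides c ((e *: w)`_i * u'`_j).
  by rewrite Eu !coefZ; congr divides; ring.
have {w0}: e *: w != 0 by rewrite scale_poly_eq0 negb_or e0.
have {le_n}: (size (e *: w)%R + size u' <= n)%N.
  by move: le_n; rewrite Eu !size_scale.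
move: (e *: w) dv i j => {}w dv i j le_n w0.
have [g [c' [a [Ec Ea cop]]]] := gcdA c (lead_coef w).
have g0 : g != 0 by apply: contraNneq c0 => g0; rewrite Ec g0 mul0r.
have dvg : forall i, divides g w`_i.
  move=> {}i; apply: prim => {}j; rewrite coef_sub_lead mulrDl; apply: dividesD.
    apply: IHn; first by apply: leq_trans le_n; rewrite ltn_add2r size_sub_lead.
    apply: divides_coef_sub_lead; last by exists a; rewrite Ea mulrC.
    by move=> m; apply: divides_trans (dv m); exists c'; rewrite Ec mulrC.
  by do 2!apply: divides_mulr; exists a; rewrite Ea mulrC.
have [w3 Ew] : divides g%:P w by apply/divides_polyC.
rewrite mulrC mul_polyC in Ew.
have dv3 m : divides c' (w3 * u')`_m.
  by have := dv m; rewrite Ew -scalerAl coefZ Ec divides_mul2l.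
have Ea3 : lead_coef w3 = a by apply: (mulfI g0); rewrite -lead_coefZ -Ew.
have dvl : divides c' (lead_coef u').
  apply: cop; first exact/divides_mull/divides_refl.
  by rewrite mulrC -Ea3 -lead_coefM /lead_coef; apply: dv3.
rewrite Ew coefZ Ec -mulrA divides_mul2l // (coef_sub_lead u') mulrDr.
apply: dividesD; last by apply: divides_mull; apply: divides_mulr.
apply: IHn.
  by apply: leq_trans le_n; rewrite Ew size_scale // ltn_add2l size_sub_lead.
by move=> m; rewrite mulrC; apply: divides_coef_sub_lead => //; rewrite mulrC.
Qed.

Lemma primitive_divides c w u : gcd_domain A -> primitive u ->
  divides c%:P (w * u) -> divides c%:P w.
Proof.
move=> gcdA prim /divides_polyC dv; apply/divides_polyC=> i.
by apply: prim => j; apply: Gauss_divides.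
Qed.

Import Pdiv.Idomain.

(** It is enough to show that [(p) : (q)] is principal.  Over the fraction field
    it is generated by [p / gcd p q]; let [h] be the primitive part of that
    element.  By Gauss' lemma every [x] in [(p) : (q)] is [u * h], and [p] divides
    [q * h] up to a nonzero constant [c], say [c *: (q * h) = (e2 *: w) * p] with
    [w] primitive.  Then [u * h] is in [(p) : (q)] exactly when [c] divides
    [e2 *: (w * u)], that is, when every coefficient of [u] is in the colon ideal
    [(c) : (e2)] of [A]. *)
Lemma gcd_domain_poly : gcd_domain A -> gcd_domain {poly A}.
Proof.
move=> gcdA; apply: gcd_domain_of_colon => p q p0.
pose g := gcdp p q.
have g0 : g != 0 by rewrite gcdp_eq0 negb_and p0.
(* [c1 *: p = p1 * g] and [c2 *: q = q1 * g], with [p1] and [q1] coprime over the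
   fraction field. *)
have := dvdp_gcdl p q; rewrite dvdp_eq -/g => /eqP.
have := dvdp_gcdr p q; rewrite dvdp_eq -/g => /eqP.
have : coprimep (p %/ g) (q %/ g) by rewrite coprimep_div_gcd ?p0.
have : lead_coef g ^+ scalp q g != 0 by rewrite expf_neq0 ?lead_coef_eq0.
have : lead_coef g ^+ scalp p g != 0 by rewrite expf_neq0 ?lead_coef_eq0.
move: (p %/ g) (q %/ g) (lead_coef g ^+ _) (lead_coef g ^+ _).
move=> p1 q1 c2 c1 c10 c20 cop Eq Ep.
have p10 : p1 != 0.
  apply: contraNneq p0 => p10; move/eqP: Ep.
  by rewrite p10 mul0r scale_poly_eq0 (negPf c10).
have [e [h [Eh primh]]] := content_primitive p1 gcdA.
have e0 : e != 0 by apply: contraNneq p10 => e0; rewrite Eh e0 scale0r.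
have colon_h (x : {poly A}) : divides p (q * x) -> divides h x.
  case=> y Ey.
  have : p1 %| q1 * x.
    apply/dvdpP; exists (c1, c2 *: y) => //=; apply: (mulIf g0).
    transitivity (c1 *: x * (q1 * g)); first by rewrite -!mul_polyC; ring.
    rewrite -Eq; transitivity ((c1 * c2) *: (q * x)).
      by rewrite -!mul_polyC polyCM; ring.
    rewrite Ey; transitivity (c2 *: y * (c1 *: p)).
      by rewrite -!mul_polyC polyCM; ring.
    by rewrite Ep; ring.
  rewrite Gauss_dvdpr // => /dvdpP[[c r] /= c0 Er].
  have [v Ev] : divides c%:P (e *: r).
    apply: (primitive_divides gcdA primh); exists x.
    by rewrite [x * _]mulrC mul_polyC Er Eh -!mul_polyC; ring.
  exists v; apply: (scale_poly_inj c0); rewrite Er Eh -scalerAr scalerAl Ev.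
  by rewrite -!mul_polyC; ring.
pose c := c2 * e; have c0 : c != 0 by rewrite mulf_neq0.
have [e2 [w [Ew primw]]] := content_primitive (c1 *: q1) gcdA.
have Ecw : c *: (q * h) = (e2 *: w) * p.
  apply: (mulfI g0); rewrite -Ew; transitivity ((c2 *: q) * ((e *: h) * g)).
    by rewrite -!mul_polyC polyCM; ring.
  by rewrite -Eh -Ep Eq -!mul_polyC; ring.
have [t tP] := colon_principal e2 gcdA c0.
exists (t%:P * h) => x; split=> [dv|[v ->]].
  have [u Eu] := colon_h x dv; rewrite Eu mulrC.
  case: dv => z Ez.
  have {}Ez : c *: z = e2 *: (w * u).
    apply: (mulIf p0); rewrite -scalerAl -Ez Eu.
    transitivity (c *: (q * h) * u); first by rewrite -!mul_polyC; ring.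
    by rewrite Ecw -!mul_polyC; ring.
  have [v Ev] : divides t%:P u.
    apply: (primitive_divides gcdA primw); apply/divides_polyC => i.
    by apply/tP; exists z`_i; rewrite [z`_i * c]mulrC -!coefZ Ez [u * w]mulrC.
  by exists v; rewrite Ev; ring.
have [s Es] : divides c (e2 * t) by apply/tP/divides_refl.
exists (s *: (v * w)); apply: (scale_poly_inj c0).
transitivity (c *: (q * h) * (v * t%:P)); first by rewrite -!mul_polyC; ring.
rewrite Ecw; transitivity ((e2 * t) *: (w * p * v)).
  by rewrite -!mul_polyC polyCM; ring.
by rewrite Es -!mul_polyC polyCM; ring.
Qed.

End Gauss.

(** * Gcds of multivariate polynomials *)

Section PolynomialRings.

Lemma gcd_domain_bij (A B : idomainType) (f : {rmorphism A -> B}) :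
  bijective f -> gcd_domain B -> gcd_domain A.
Proof.
move=> [f' fK f'K] gcdB a b.
have divf x y : divides (f x) (f y) <-> divides x y.
  split=> [[z Ez]|[z ->]]; last by exists (f z); rewrite rmorphM.
  by exists (f' z); apply: (can_inj fK); rewrite rmorphM f'K.
have [g [a' [b' [Ea Eb cop]]]] := gcdB (f a) (f b).
exists (f' g), (f' a'), (f' b'); split=> [||h x dva dvb].
- by apply: (can_inj fK); rewrite rmorphM !f'K.
- by apply: (can_inj fK); rewrite rmorphM !f'K.
by apply/divf/cop; [rewrite -(f'K a') | rewrite -(f'K b')];
  rewrite -rmorphM; apply/divf.
Qed.

Lemma gcd_domain_field (k : fieldType) : gcd_domain k.
Proof.
apply: gcd_domain_of_colon => a b a0; exists 1 => x.
split=> _; [by exists x; rewrite mulr1 | exists (b * x / a)].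
by rewrite divfK.
Qed.

Variable R : idomainType.

Lemma muniX n (m : 'X_{1..n.+1}) :
  muni ('X_[R, m]) =
  'X_[[multinom (m (widen_ord (leqnSn n) i)) | i < n]] *: 'X^(m ord_max).
Proof. by rewrite muniE msuppX big_seq1 mcoeffX eqxx scale1r. Qed.

(** The inverse evaluates the last variable at ['X_ord_max]. *)
Lemma muni_bij n : bijective (@muni n R).
Proof.
pose psi (q : {poly {mpoly R[n]}}) : {mpoly R[n.+1]} :=
  (map_poly (@mwiden n R) q).['X_ord_max].
have psiD : {morph psi : p q / p + q} by move=> p q; rewrite /psi rmorphD hornerD.
exists psi => [p|q].
  rewrite muniE (big_morph psi psiD (id1 := 0)); last first.
    by rewrite /psi rmorph0 horner0.
  rewrite [RHS]mpolyE; apply: eq_bigr => m _.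
  rewrite /psi map_polyZ map_polyXn hornerZ hornerXn /= mwidenZ mwidenX -scalerAl.
  congr (_ *: _); rewrite mpolyXn -mpolyXD; congr 'X_[_].
  apply/mnmP => i; rewrite mnmDE mulmnE mnm1E.
  have [->|ne] := eqVneq i ord_max.
    by rewrite mnmwiden_ordmax mul1n.
  have lt_in : (i < n)%N by rewrite ltn_neqAle ne -ltnS ltn_ord.
  have -> : i = widen_ord (leqnSn n) (Ordinal lt_in) by apply: val_inj.
  by rewrite mnmwiden_widen mnmE mul0n addn0.
elim/poly_ind: q => [|q c IHq]; first by rewrite /psi rmorph0 horner0 muni0.
rewrite psiD muniD; congr (_ + _).
  rewrite /psi rmorphM /= map_polyX hornerMX muniM IHq; congr (_ * _).
  rewrite muniX.
  rewrite mnm1E eqxx expr1 (_ : [multinom _ | _ < _] = 0%MM) ?mpolyX0 ?scale1r //.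
  apply/mnmP => i; rewrite mnmE mnm1E mnm0E (_ : _ == _ = false) //.
  by apply/eqP=> /(congr1 val) /= E; have := ltn_ord i; rewrite -E ltnn.
rewrite /psi map_polyC hornerC /=.
elim/mpolyind: c => [|a m p _ _ IHp]; first by rewrite mwiden0 muni0.
rewrite mwidenD muniD IHp polyCD; congr (_ + _).
rewrite mwidenZ muniZ mwidenX muniX mnmwiden_ordmax expr0 -!mul_polyC mulr1 -polyCM.
rewrite mul_mpolyC; congr ((_ *: 'X_[_])%:P).
by apply/mnmP => i; rewrite mnmE mnmwiden_widen.
Qed.

Lemma mcoeff0_bij : bijective (@mcoeff 0 R 0%MM).
Proof.
by exists (@mpolyC 0 R) => [p|c]; rewrite ?mcoeffC ?eqxx ?mulr1 // -nvar0_mpolyC.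
Qed.

End PolynomialRings.

Lemma gcd_domain_mpoly (k : fieldType) n : gcd_domain {mpoly k[n]}.
Proof.
elim: n => [|n IHn].
  exact: gcd_domain_bij (mcoeff0_bij k) (@gcd_domain_field k).
exact: gcd_domain_bij (muni_bij k n) (gcd_domain_poly IHn).
Qed.

(** * Free syzygy modules *)

Section FreeKernels.
Variable A : idomainType.

Definition row_basis (s m : nat) (W : 'M[A]_(s, m)) (K : 'rV[A]_m -> Prop) : Prop :=
  (forall a, K a <-> exists t : 'rV_s, a = t *m W) /\
  (forall t : 'rV_s, t *m W = 0 -> t = 0).

Definition free_kernel (m c : nat) (L : 'M[A]_(m, c)) : Prop :=
  exists s (W : 'M[A]_(s, m)), row_basis W (fun a => a *m L = 0).

Lemma free_kernel_mull m c (U : 'M[A]_m) (L : 'M_(m, c)) :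
  U \in unitmx -> free_kernel L -> free_kernel (U *m L).
Proof.
move=> unitU [s [W [kerW injW]]]; exists s, (W *m invmx U); split=> [a|t].
  rewrite mulmxA kerW; split=> -[t Et]; exists t.
    by rewrite mulmxA -Et mulmxK.
  by rewrite Et mulmxA mulmxKV.
by move=> /(congr1 (mulmx^~ U)); rewrite mul0mx mulmxA mulmxKV // => /injW.
Qed.

Lemma free_kernel_col0 m p c (L : 'M[A]_(m, c)) :
  free_kernel L -> free_kernel (col_mx L (0 : 'M_(p, c))).
Proof.
move=> [s [W [kerW injW]]]; exists (s + p)%N, (block_mx W 0 0 1%:M).
split=> [a|t].
  rewrite -[a]hsubmxK mul_row_col mulmx0 addr0 kerW; split=> -[t Et].
    exists (row_mx t (rsubmx a)).
    by rewrite mul_row_block !mulmx0 mulmx1 addr0 add0r -Et.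
  exists (lsubmx t); move: Et.
  by rewrite -{1}[t]hsubmxK mul_row_block !mulmx0 addr0 => /eq_row_mx[].
rewrite -[t]hsubmxK mul_row_block !mulmx0 mulmx1 addr0 add0r -row_mx0.
by move=> /eq_row_mx[/injW-> ->]; rewrite row_mx0.
Qed.

Lemma free_kernel_zero m c (L : 'M[A]_(m, c)) : L = 0 -> free_kernel L.
Proof.
move->; exists m, 1%:M; split=> [a|t]; last by rewrite mulmx1.
by rewrite mulmx0; split=> // _; exists a; rewrite mulmx1.
Qed.

Lemma free_kernel1 (L : 'cV[A]_1) : free_kernel L.
Proof.
have [/free_kernel_zero//|L0] := eqVneq L 0.
exists 0%N, 0; split=> [a|t]; last by rewrite [t]thinmx0.
split=> [/matrixP/(_ 0 0)|[t ->]]; last by rewrite mulmx0 mul0mx.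
rewrite !mxE big_ord1 => /eqP; rewrite mulf_eq0 => /orP[/eqP a0|/eqP l0].
  by exists 0; rewrite mul0mx; apply/matrixP=> i j; rewrite !ord1 a0 mxE.
by case/eqP: L0; apply/matrixP=> i j; rewrite !ord1 l0 mxE.
Qed.

(** With [p] and [q] the entries divided by their gcd [g], the relation
    [a_0 p + a_1 q = 0] forces [q] to divide [a_0] and [p] to divide [a_1], so the
    kernel is spanned by [(q, - p)]. *)
Lemma free_kernel2 (L : 'cV[A]_2) : gcd_domain A -> free_kernel L.
Proof.
move=> gcdA; have [/free_kernel_zero//|L0] := eqVneq L 0.
have [g [p [q [Ep Eq cop]]]] := gcdA (L 0 0) (L 1 0).
have EL (a : 'rV_2) : a *m L = (g * (a 0 0 * p + a 0 1 * q))%:M.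
  apply/matrixP=> i j; rewrite !ord1 !mxE mulr1n big_ord_recl big_ord1.
  by rewrite (_ : lift _ _ = 1) ?Ep ?Eq; [ring | apply: val_inj].
have ord2 (i : 'I_2) : i = 0 \/ i = 1.
  by case: i => [[|[|//]]] lt; [left | right]; apply: val_inj.
have colL0 : L 0 0 = 0 -> L 1 0 = 0 -> L == 0.
  move=> E0 E1; apply/eqP/matrixP=> i j; rewrite ord1 mxE.
  by case: (ord2 i) => ->.
have g0 : g != 0.
  by apply: contraNneq L0 => g0; apply: colL0; rewrite ?Ep ?Eq g0 mul0r.
pose W : 'rV[A]_2 := \row_j (if j == 0 then q else - p).
have W0 (t : 'rV_1) : (t *m W) 0 0 = t 0 0 * q by rewrite mxE big_ord1 mxE.
have W1 (t : 'rV_1) : (t *m W) 0 1 = - (t 0 0 * p).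
  by rewrite mxE big_ord1 mxE /= mulrN.
have eqrow (a b : 'rV[A]_2) : a 0 0 = b 0 0 -> a 0 1 = b 0 1 -> a = b.
  move=> E0 E1; apply/rowP=> j.
  by case: (ord2 j) => ->.
have pq0 : (p != 0) || (q != 0).
  rewrite -negb_and; apply: contra L0 => /andP[/eqP p0 /eqP q0].
  by apply: colL0; rewrite ?Ep ?Eq ?p0 ?q0 mulr0.
exists 1%N, W; split=> [a|t tW0].
  rewrite EL; split=> [/matrixP/(_ 0 0)|[t ->]].
    rewrite !mxE mulr1n => /eqP; rewrite mulf_eq0 (negPf g0) /= => /eqP Ea.
    have Ea' : a 0 1 * q = - (a 0 0 * p) by apply/eqP; rewrite -addr_eq0 addrC Ea.
    have [t0 Et0] : divides q (a 0 0).
      apply: cop; last exact/divides_mull/divides_refl.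
      by exists (- a 0 1); rewrite mulNr Ea' opprK.
    have [t1 Et1] : divides p (a 0 1).
      apply: cop; first exact/divides_mull/divides_refl.
      by exists (- a 0 0); rewrite mulNr Ea'.
    (* The common quotient must be read off at a nonzero entry of [(q, - p)]. *)
    case/orP: pq0 => [p0|q0].
      exists (- t1)%:M; apply: eqrow; rewrite ?W0 ?W1 mxE mulr1n; last first.
        by rewrite Et1; ring.
      by apply: (mulIf p0); rewrite -[LHS]opprK -Ea' Et1; ring.
    exists t0%:M; apply: eqrow; rewrite ?W0 ?W1 mxE mulr1n //.
    by apply: (mulIf q0); rewrite Ea' Et0; ring.
  by rewrite W0 W1; apply/matrixP=> i j; rewrite !ord1 !mxE; ring.
have /esym/eqP := W0 t; have /esym/eqP := W1 t.
rewrite tW0 !mxE oppr_eq0 !mulf_eq0 => E1 E0.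
apply/matrixP=> i j; rewrite !ord1 mxE; apply/eqP.
by case/orP: pq0 => /negPf n0; [move: E1 | move: E0]; rewrite n0 orbF.
Qed.

(** Elimination over [k] leaves at most [r <= 2] nonzero rows of [P], and these may
    be put on top by the invertible factor [col_ebase P]. *)
Lemma free_kernel_rank2 (k : fieldType) (f : {rmorphism k -> A}) m r
    (P : 'M[k]_(m, r)) (B : 'cV[A]_r) :
  gcd_domain A -> (r <= 2)%N -> free_kernel (map_mx f P *m B).
Proof.
move=> gcdA le_r2; have [le2m|] := leqP 2 m; last first.
  case: m P => [|[|//]] P _; last exact: free_kernel1.
  by apply: free_kernel_zero; apply/matrixP=> -[].
move: P; rewrite -(subnKC le2m) => P.
rewrite -[P]mulmx_ebase !map_mxM /= -!mulmxA.
apply: free_kernel_mull; first by rewrite map_unitmx col_ebase_unit.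
have -> : pid_mx (\rank P) = col_mx (pid_mx (\rank P)) 0 :> 'M[k]_(2 + (m - 2), r).
  apply/matrixP=> i j; rewrite !mxE; case: splitP=> i' ->; rewrite !mxE //.
  rewrite (_ : (_ < \rank P)%N = false) ?andbF //.
  apply/negbTE; rewrite -leqNgt.
  exact: leq_trans (rank_leq_col P) (leq_trans le_r2 (leq_addr _ _)).
rewrite map_col_mx map_mx0 mul_col_mx mul0mx.
by apply: free_kernel_col0; apply: free_kernel2.
Qed.

(** Syzygies that vanish wherever the label does are the syzygies of the nonzero
    labels, extended by zero. *)
Lemma supported_kernel_free n (L : 'cV[A]_n) :
  (forall m (g : 'I_m -> 'I_n), free_kernel (rowsub g L)) ->
  exists s (W : 'M[A]_(s, n)), row_basis W
    (fun a => a *m L = 0 /\ forall i, L i 0 = 0 -> a 0 i = 0).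
Proof.
pose N := [set i | L i 0 != 0]; pose g : 'I_#|N| -> 'I_n := enum_val.
move=> /(_ _ g)[s [W [kerW injW]]]; pose E : 'M[A]_(#|N|, n) := rowsub g 1%:M.
have EET : E *m E^T = 1%:M.
  apply/matrixP=> i j; rewrite !mxE (bigD1 (g i)) //= !mxE eqxx mul1r big1 ?addr0.
    by rewrite (inj_eq enum_val_inj) eq_sym.
  by move=> h ne; rewrite !mxE eq_sym (negPf ne) mul0r.
exists s, (W *m E); split=> [a|t].
  split=> [[aL supp]|[t ->]].
    have Ea : a = a *m E^T *m E.
      apply/rowP=> i; rewrite !mxE.
      have aE j : (a *m E^T) 0 j = a 0 (g j).
        rewrite mxE (bigD1 (g j)) //= !mxE eqxx mulr1 big1 ?addr0 // => h ne.
        by rewrite !mxE eq_sym (negPf ne) mulr0.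
      have [/supp ai0|Li] := eqVneq (L i 0) 0.
        rewrite ai0 big1 // => j _; rewrite aE !mxE.
        by case: eqP => [->|_]; rewrite ?ai0 (mul0r, mulr0).
      have iN : i \in N by rewrite inE.
      rewrite (bigD1 (enum_rank_in iN i)) //= aE !mxE /g enum_rankK_in //.
      rewrite eqxx mulr1 big1 ?addr0 // => j ne; rewrite !mxE.
      case: eqP => [Ei|_]; rewrite ?mulr0 //; case/eqP: ne.
      by apply: enum_val_inj; rewrite enum_rankK_in.
    have [|t Et] := (kerW (a *m E^T)).1; first by rewrite rowsubE mulmxA -Ea.
    by exists t; rewrite mulmxA -Et.
  split.
    by rewrite mulmxA -mulmxA -rowsubE; apply/kerW; exists t.
  move=> i Li; rewrite mulmxA mxE big1 // => j _; rewrite !mxE.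
  case: eqP => [E'|]; rewrite ?mulr0 //.
  by have := enum_valP j; rewrite inE -/(g j) E' Li eqxx.
move=> /(congr1 (mulmx^~ E^T)).
by rewrite mul0mx mulmxA -mulmxA EET mulmx1; apply: injW.
Qed.

End FreeKernels.

(** * Bases of modules *)

Section FreeModules.
Variables (A : nzRingType) (M : lmodType A).

Lemma in_span_ord r (b : 'I_r -> M) x :
  in_span b x -> exists c : 'I_r -> A, x = \sum_i c i *: b i.
Proof.
case=> s [c ->]; elim: s => [|j s [c' IHs]].
  by exists (fun=> 0); rewrite big_nil big1 // => i _; rewrite scale0r.
exists (fun i => c i *+ (i == j) + c' i); rewrite big_cons IHs.
under [RHS]eq_bigr do rewrite scalerDl.
rewrite big_split; congr (_ + _); rewrite (bigD1 j) //= eqxx mulr1n.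
by rewrite big1 ?addr0 // => i /negPf->; rewrite mulr0n scale0r.
Qed.

Lemma free_module_of_bij r (f : 'rV[A]_r -> M) :
  linear f -> (forall x, exists t, x = f t) -> (forall t, f t = 0 -> t = 0) ->
  is_free_module M.
Proof.
move=> linf surjf injf.
pose linI := GRing.isLinear.Build A 'rV[A]_r M _ f linf.
pose F : {linear 'rV[A]_r -> M} := HB.pack f linI.
have sumf (c : 'I_r -> A) : \sum_i c i *: f (delta_mx 0 i) = f (\row_i c i).
  rewrite -[RHS]/(F _) [\row_i _]row_sum_delta linear_sum.
  by apply: eq_bigr => i _; rewrite linearZ mxE.
exists 'I_r, (fun i => f (delta_mx 0 i)); split=> [s c uniq_s|x].
  have -> : \sum_(i <- s) c i *: f (delta_mx 0 i) =
            \sum_i (if i \in s then c i else 0) *: f (delta_mx 0 i).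
    rewrite (big_uniq _ uniq_s) /= big_mkcond; apply: eq_bigr => i _.
    by case: ifP; rewrite ?scale0r.
  rewrite sumf => /injf/rowP c0 i si; have := c0 i.
  by rewrite !mxE si.
have [t ->] := surjf x.
exists (index_enum 'I_r), (fun i => t 0 i); rewrite sumf; congr f.
by apply/rowP=> i; rewrite mxE.
Qed.

End FreeModules.

(** * Splines on cycles *)

Section CycleSplines.

Lemma sum_ltS (V : zmodType) n (D : 'I_n -> V) (i : 'I_n) m : m = i.+1 ->
  \sum_(j < n | (j < m)%N) D j = \sum_(j < n | (j < i)%N) D j + D i.
Proof.
move=> ->; rewrite (bigD1 i) //= addrC; congr (_ + _).
by apply: eq_bigl => j; rewrite ltnS andbC -ltn_neqAle.
Qed.

Lemma sum_lt_last (V : zmodType) n (D : 'I_n -> V) (i : 'I_n) : n = i.+1 ->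
  \sum_j D j = \sum_(j < n | (j < i)%N) D j + D i.
Proof.
by move=> En; rewrite -(sum_ltS _ En); apply: eq_bigl => j; rewrite ltn_ord.
Qed.

(** Partial sums along the cycle obey their recurrence also across the closing
    edge, where [ordS] wraps around to [0], as soon as the total vanishes. *)
Lemma sum_lt_step (V : zmodType) n (D : 'I_n -> V) (i : 'I_n) :
  \sum_j D j = 0 ->
  \sum_(j < n | (j < ordS i)%N) D j = \sum_(j < n | (j < i)%N) D j + D i.
Proof.
move=> D0; have [lt_in|] := ltnP i.+1 n.
  by apply: sum_ltS; rewrite /= modn_small.
move=> le; have En : n = i.+1 by apply/eqP; rewrite eqn_leq le ltn_ord.
rewrite -(sum_lt_last _ En) D0 big_pred0 // => j.
by rewrite /= -En modnn ltn0.
Qed.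

Lemma sum_lt_telescope (V : zmodType) n (h : 'I_n.+1 -> V) (i : 'I_n.+1) :
  \sum_(j < n.+1 | (j < i)%N) (h (ordS j) - h j) = h i - h ord0.
Proof.
case: i => m; elim: m => [|m IHm] lt_m.
  rewrite big_pred0 ?ltn0 // (_ : Ordinal lt_m = ord0) ?subrr //; exact: val_inj.
have lt_m' := ltnW lt_m; rewrite (@sum_ltS _ _ _ (Ordinal lt_m')) // IHm.
rewrite (_ : ordS _ = Ordinal lt_m).
  by rewrite addrC addrA subrK.
by apply: val_inj; rewrite /= modn_small.
Qed.

(** The coordinates of a spline are its value at one vertex and a syzygy of the
    nonzero labels, so the hypothesis is applied to the [g] that lists the edges
    with such labels. *)
Lemma cycle_splines_free (R : idomainType) (n : nat) (C : graph)
    (l : edge C -> R) :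
  is_cycle n C ->
  (forall m (g : 'I_m -> edge C), free_kernel (\col_i l (g i))) ->
  is_free_module (spline (fun e : edge C => principal (l e))).
Proof.
case=> n2 [v [[idx vK idxK] EC]] free_l.
case: n => // n in n2 v idx vK idxK EC *.
have edgeP i : [set v i; v (ordS i)] \in edges C.
  by rewrite EC; apply/imsetP; exists i.
have edgeI E : E \in edges C -> exists i, E = [set v i; v (ordS i)].
  by rewrite EC => /imsetP[i _ ->]; exists i.
pose e i : edge C := exist (fun E => E \in edges C) _ (edgeP i).
pose L : 'cV[R]_n.+1 := \col_i l (e i).
have [s [W [kerW injW]]] : exists s (W : 'M[R]_(s, n.+1)), row_basis W
    (fun a => a *m L = 0 /\ forall i, L i 0 = 0 -> a 0 i = 0).
  apply: supported_kernel_free => m g; have := free_l m (e \o g).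
  by congr free_kernel; apply/matrixP=> i j; rewrite !mxE.
(* The first coordinate of [t] is the value at [v ord0]; the others are the
   coordinates of a syzygy, whose partial sums give the other values. *)
pose F (t : 'rV[R]_(1 + s)) : {ffun C -> R^o} :=
  [ffun x : C => lsubmx t 0 0 +
     \sum_(j < n.+1 | (j < idx x)%N) (rsubmx t *m W) 0 j * L j 0].
have sumL (a : 'rV_n.+1) : (a *m L) 0 0 = \sum_j a 0 j * L j 0 by rewrite mxE.
have addDBl (x y z : R) : x + (y + z) - (x + y) = z by ring.
have Fdiff t i : F t (v (ordS i)) - F t (v i) = (rsubmx t *m W) 0 i * L i 0.
  rewrite !ffunE !vK sum_lt_step; first exact: addDBl.
  rewrite -sumL; have [|-> _] := (kerW (rsubmx t *m W)).2; last by rewrite mxE.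
  by exists (rsubmx t).
have Fspline t : F t \in spline_pred (fun e : edge C => principal (l e)).
  apply/asboolP=> e' x y Exy; apply/asboolP.
  have [i Ei] := edgeI _ (valP e').
  have {}Ei : e' = e i by apply: val_inj.
  have dF : F t (v (ordS i)) - F t (v i) = (rsubmx t *m W) 0 i * l (e i).
    by rewrite Fdiff !mxE.
  rewrite {}Ei in Exy *.
  have /set2P[->|->] : x \in [set v i; v (ordS i)] by rewrite [_ :|: _]Exy set21.
    have /set2P[->|->] : y \in [set v i; v (ordS i)] by rewrite [_ :|: _]Exy set22.
      by exists 0; rewrite subrr mul0r.
    by exists (- (rsubmx t *m W) 0 i); rewrite mulNr -dF opprB.
  have /set2P[->|->] : y \in [set v i; v (ordS i)] by rewrite [_ :|: _]Exy set22.
    by exists ((rsubmx t *m W) 0 i).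
  by exists 0; rewrite subrr mul0r.
pose f t := Spline (Fspline t).
apply: (@free_module_of_bij _ _ (1 + s) f).
- move=> c t1 t2; apply: val_inj; apply/ffunP=> x /=; rewrite !ffunE !linearP /=.
  rewrite mulmxDl -scalemxAl !mxE scalerDr addrACA; congr (_ + _).
  rewrite scaler_sumr -big_split; apply: eq_bigr => j _.
  by rewrite !mxE mulrDl -mulrA.
- case=> h hS; move/asboolP: (hS) => splh.
  have /choice[q Eq] i : exists q, h (v (ordS i)) - h (v i) = q * l (e i).
    by apply/asboolP/(splh (e i)); rewrite /= setUC.
  pose a : 'rV[R]_n.+1 := \row_i (if L i 0 == 0 then 0 else q i).
  have aL i : a 0 i * L i 0 = h (v (ordS i)) - h (v i).
    by rewrite Eq !mxE; case: eqP => [->|]; rewrite ?mulr0.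
  have [|t Et] := (kerW a).1.
    split=> [|i Li]; last by rewrite mxE Li eqxx.
    apply/matrixP=> i j; rewrite !ord1 sumL mxE; under eq_bigr do rewrite aL.
    by rewrite sumrB [X in _ - X](reindex_inj (@ordS_inj _)) subrr.
  exists (row_mx (h (v ord0))%:M t); apply: val_inj; apply/ffunP=> x /=.
  rewrite ffunE row_mxKl row_mxKr -Et mxE mulr1n; under eq_bigr do rewrite aL.
  by rewrite (sum_lt_telescope (h \o v)) /= idxK addrC subrK.
move=> t /(congr1 val) /= Ft0.
have [_ supp] := (kerW (rsubmx t *m W)).2 (ex_intro _ _ erefl).
have a0 : rsubmx t *m W = 0.
  apply/rowP=> i; rewrite [RHS]mxE; have := Fdiff t i.
  rewrite Ft0 !ffunE subrr => /esym/eqP; rewrite mulf_eq0.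
  by case/orP=> /eqP; last exact: supp.
have l0 : lsubmx t = 0.
  apply/matrixP=> i j; rewrite !ord1 [RHS]mxE.
  have /ffunP/(_ (v ord0)) := Ft0; rewrite !ffunE vK big_pred0 ?addr0 //.
by rewrite -[t]hsubmxK l0 (injW _ a0) row_mx0.
Qed.

End CycleSplines.

Theorem proposition5p7 (k : fieldType) (d n : nat) (C : graph)
    (l : edge C -> {mpoly k[d]}) (rk : nat) :
  is_cycle n C ->
  span_dim l rk ->
  (rk <= 2)%N ->
  is_free_module (spline (fun e : edge C => principal (l e))).
Proof.
move=> cycC [b [_ spanb]] le_rk2; apply: (cycle_splines_free cycC) => m g.
have /choice[P EP] i : exists c : 'I_rk -> k, l (g i) = \sum_j c j *: b j.
  apply/in_span_ord/spanb; exists [:: g i], (fun=> 1).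
  by rewrite big_seq1 scale1r.
have -> : (\col_i l (g i)) =
    map_mx (@mpolyC d k) (\matrix_(i, j) P i j) *m \col_j b j.
  apply/matrixP=> i j; rewrite !mxE EP; apply: eq_bigr => h _.
  by rewrite !mxE mul_mpolyC.
by apply: free_kernel_rank2 => //; apply: gcd_domain_mpoly.
Qed.
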